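(* Let $N$ be a nonempty set, $\mathcal{B}\subseteq 2^N$ a Boolean algebra of subsets of $N$, $\mathcal{B}'$ a collection of subsets of $N$ with $\mathcal{B}\subseteq\mathcal{B}'$, and $\mathcal{W}'\subseteq\mathcal{B}'$ a collection of winning sets. Let $\mathcal{W}=\mathcal{W}'\cap\mathcal{B}$. Then $$2\le\nu'(\mathcal{W}')\le\kappa(\mathcal{W}')\le\nu(\mathcal{W}).$$
   Context: A collection of winning sets is a subcollection $\mathcal{W}'\subseteq\mathcal{B}'$ with $\emptyset\notin\mathcal{W}'$ and $\mathcal{W}'\neq\emptyset$. $\#Y$ denotes the cardinal number of $Y$; $+\infty$ is understood to be greater than any cardinal number. The intersection of an empty family of subsets of $N$ is $N$. Nakamura number: for $\mathcal{W}\subseteq\mathcal{B}$, $\nu(\mathcal{W})=\min\{\#\mathcal{V}:\mathcal{V}\subseteq\mathcal{W},\ \bigcap\mathcal{V}=\emptyset\}$ if $\bigcap\mathcal{W}=\emptyset$; otherwise $\nu(\mathcal{W})=+\infty$. The number $\nu'(\mathcal{W}')$ is defined by exactly the same formula with $\mathcal{W}$ replaced by the collection $\mathcal{W}'\subseteq\mathcal{B}'$ of winning sets. Kappa number: a ($\mathcal{B}$-)cover of $S'\in\mathcal{B}'$ is a nonempty collection $\mathcal{C}\subseteq\mathcal{B}$ with $\bigcup\mathcal{C}\supseteq S'$. Let $M(\mathcal{W}')$ be the collection of pairs $(\mathcal{Y},\mathcal{Z})$ such that (a) $\mathcal{Y}\subseteq\mathcal{W}'$, and (b) $\mathcal{Z}$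 assigns to each $W\in\mathcal{Y}$ a $\mathcal{B}$-cover $\mathcal{Z}(W)\subseteq\mathcal{B}$ of $W$, in such a way that $\bigcap_{W\in\mathcal{Y}}\bigcup\mathcal{Z}(W)=\emptyset$. Then $\kappa(\mathcal{W}')=+\infty$ if $M(\mathcal{W}')=\emptyset$; otherwise $$\kappa(\mathcal{W}')=\min_{(\mathcal{Y},\mathcal{Z})\in M(\mathcal{W}')}\max\{\#\mathcal{Y},\ \sup\{\#\mathcal{Z}(W):W\in\mathcal{Y}\}\}.$$ *)

(* Defs.v *)
From HB Require Import structures.
From mathcomp Require Import all_boot.
From mathcomp Require Import boolp classical_sets functions cardinality.
From mathcomp Require Import measurable_structure.

Set Implicit Arguments.
Unset Strict Implicit.
Unset Printing Implicit Defensive.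

Local Open Scope classical_set_scope.

(* A cardinal number at most that of T is an equipotence class of subsets of T,
   so equality in cardinal T is equality of cardinal numbers. These cardinal
   numbers form an initial segment of all cardinal numbers, so their minima and
   suprema are those taken among all cardinal numbers. *)
Definition cardinal (T : Type) : Type :=
  {C : set (set T) | exists A : set T, C = [set A' | (A' #= A)%card]}.

HB.instance Definition _ (T : Type) := gen_eqMixin (cardinal T).
HB.instance Definition _ (T : Type) := gen_choiceMixin (cardinal T).

Definition cardinality (T : Type) (A : set T) : cardinal T :=
  exist _ [set A' | (A' #= A)%card] (ex_intro _ A erefl).

Definition cardinal_le (T U : Type) (c : cardinal T) (d : cardinal U) : Prop :=
  exists A B, [/\ c = cardinality A, d = cardinality B & (A #<= B)%card].

Section CardinalOperations.
Variable T : Type.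
Implicit Types (c d e : cardinal T) (X : set (cardinal T)).

Definition cardinal_max c d : cardinal T :=
  if `[< cardinal_le c d >] then d else c.

(* The default value is never taken when X is nonempty, since cardinal numbers
   are well-ordered. *)
Definition cardinal_min X : cardinal T :=
  xget (cardinality set0) [set c | X c /\ forall d, X d -> cardinal_le c d].

(* The default value is never taken, since cardinality [set: T] is an upper
   bound of every X. *)
Definition cardinal_sup X : cardinal T :=
  xget (cardinality set0)
    [set c | (forall d, X d -> cardinal_le d c) /\
       forall e, (forall d, X d -> cardinal_le d e) -> cardinal_le c e].

End CardinalOperations.

(* None stands for +oo, which is greater than any cardinal number. *)
Definition ecardinal (T : Type) : Type := option (cardinal T).

Definition ecardinal_le (T U : Type) (x : ecardinal T) (y : ecardinal U) :
    Prop :=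
  match x, y with
  | _, None => True
  | None, Some _ => False
  | Some c, Some d => cardinal_le c d
  end.

Notation "x <=c y" := (ecardinal_le x y) (at level 70, no associativity).

Section SetCollections.
Variable N : Type.
Implicit Types (B W V C Y : set (set N)) (S : set N).

Definition boolean_algebra B : Prop :=
  [/\ B set0, setU_closed B & setC_closed B].

Definition winning_sets B' W' : Prop :=
  [/\ W' `<=` B', ~ W' set0 & W' !=set0].

(* The intersection of the empty collection is [set: N]. *)
Definition nakamura W : ecardinal (set N) :=
  if `[< \bigcap_(S in W) S = set0 >] then
    Some (cardinal_min [set cardinality V | V in
      [set V | V `<=` W /\ \bigcap_(S in V) S = set0]])
  else None.

Definition is_cover B S C : Prop :=
  [/\ C !=set0, C `<=` B & S `<=` \bigcup_(A in C) A].

(* In a pair (Y, Z) the assignment Z is a total function on set N, of which only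
   the values on Y matter. *)
Definition cover_pairs B W' : set (set (set N) * (set N -> set (set N))) :=
  [set YZ | [/\ YZ.1 `<=` W',
                forall S, YZ.1 S -> is_cover B S (YZ.2 S)
              & \bigcap_(S in YZ.1) \bigcup_(A in YZ.2 S) A = set0]].

Definition kappa B W' : ecardinal (set N) :=
  if `[< cover_pairs B W' = set0 >] then None
  else Some (cardinal_min
    [set cardinal_max (cardinality YZ.1)
           (cardinal_sup [set cardinality (YZ.2 S) | S in YZ.1])
      | YZ in cover_pairs B W']).

End SetCollections.

(* Main.v *)
Require Import Defs.
From mathcomp Require Import all_boot.
From mathcomp Require Import boolp classical_sets functions cardinality.
Local Open Scope classical_set_scope.

(** The well-ordering of cardinals makes the minima defining the Nakamura and
    kappa numbers attained.  A family attaining [nakamura W'] has empty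
    intersection, so it is neither empty nor a singleton.  If [(Y, Z)] attains
    [kappa B W'], then [Y] itself has empty intersection, each of its members
    being contained in the union of its cover.  If [V] attains [nakamura W],
    then covering each [S] in [V] by the singleton [[set S]] gives a pair whose
    cardinal is that of [V]. *)

Lemma cardinalityP {T : Type} (c : cardinal T) :
  exists A, c = cardinality A.
Proof. by case: c => C [A CA]; exists A; apply: eq_exist. Qed.

Lemma cardinality_eqE {T : Type} (A B : set T) :
  cardinality A = cardinality B <-> (A #= B)%card.
Proof.
split=> [/(congr1 sval)/= AB|AB].
  (* [A] lies in its own class, hence in that of [B]. *)
  have : [set A' | (A' #= A)%card] A by exact: card_eqxx.
  by rewrite AB.
by apply: eq_exist; apply/seteqP; split=> C /=; rewrite (card_eqr AB).
Qed.

(** Equipotence preserves [#<=] on both sides, so the comparison does not depend on the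
    representatives. *)
Lemma cardinal_leE {T U : Type} (A : set T) (B : set U) :
  cardinal_le (cardinality A) (cardinality B) <-> (A #<= B)%card.
Proof.
split=> [[A' [B' [/cardinality_eqE AA' /cardinality_eqE BB' A'B']]]|AB].
  by rewrite (card_le_eql AA') (card_le_eqr BB').
by exists A, B.
Qed.

Lemma cardinal_le_refl {T : Type} (c : cardinal T) : cardinal_le c c.
Proof. by have [A ->] := cardinalityP c; apply/cardinal_leE. Qed.

Lemma cardinal_le_trans {T U V : Type} (d : cardinal U) (c : cardinal T)
  (e : cardinal V) : cardinal_le c d -> cardinal_le d e -> cardinal_le c e.
Proof.
have [[A ->] [B ->] [C ->]] :=
  And3 (cardinalityP c) (cardinalityP d) (cardinalityP e).
by move=> /cardinal_leE AB /cardinal_leE BC; apply/cardinal_leE/(card_le_trans AB).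
Qed.

(* Zorn's lemma gives a maximal set of choice functions that differ pairwise at
   every index; by maximality, its values at some index fill [A i], while at
   each index [j] they are as many as the functions. *)
Lemma exists_min_card {I T : Type} (D : set I) (A : I -> set T) :
  D !=set0 -> exists2 i, D i & forall j, D j -> (A i #<= A j)%card.
Proof.
move=> [i0 Di0].
pose P (G : set (I -> T)) :=
  (forall f i, G f -> D i -> A i (f i)) /\
  (forall f g i, G f -> G g -> D i -> f i = g i -> f = g).
have [G [[GA Ginj] Gmax]] : exists G, P G /\ forall H, G `<` H -> ~ P H.
  apply: Zorn_bigcup => F FP Ftot; split=> [f i [G FG Gf] Di|].
    by have [+ _] := FP _ FG; apply.
  move=> f g i [G FG Gf] [H FH Hg] Di.
  have [GH|HG] := Ftot _ _ FG FH.
    by have [_ +] := FP _ FH; apply=> //; exact: GH.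
  by have [_ +] := FP _ FG; apply=> //; exact: HG.
have [i Di Ai] : exists2 i, D i & A i `<=` (fun f => f i) @` G.
  apply: contrapT => nfill.
  (* If no index is filled, every index in [D] has a value missed by all of [G]; choosing such
     values yields a function [h] that can be added to [G], against maximality. *)
  have new i : D i -> exists2 a, A i a & forall f, G f -> f i <> a.
    move=> Di; apply: contrapT => nnew; apply: nfill; exists i => // a Aia.
    apply: contrapT => Ga; apply: nnew; exists a => // f Gf fia.
    by apply: Ga; exists f.
  (* [t0] serves as the value of [h] outside [D]. *)
  have [t0 _ _] := new _ Di0.
  have [h hP] : {h : I -> T & forall i, D i ->
      A i (h i) /\ forall f, G f -> f i <> h i}.
    apply: (@choice _ _ (fun i a => D i -> A i a /\ forall f, G f -> f i <> a)).
    move=> i; have [/new[a Aa Ga]|nDi] := pselect (D i); first by exists a.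
    by exists t0.
  apply: (Gmax (G `|` [set h])).
    (* Were [h] in [G], it would differ from itself at [i0]. *)
    split=> [f Gf|/(_ h (or_intror erefl)) Gh]; first by left.
    by have [_ /(_ h Gh)] := hP _ Di0.
  split=> [f i [Gf|->] Di|f g i [Gf|->] [Gg|->] Di] //.
  - exact: GA.
  - by have [] := hP _ Di.
  - exact: Ginj Di.
  - by move=> fh; have [_ /(_ f Gf)] := hP _ Di.
  - by move=> hg; have [_ /(_ g Gg)] := hP _ Di; rewrite hg.
exists i => // j Dj.
apply: card_le_trans (subset_card_le Ai) _.
apply: card_le_trans (card_image_le _ _) _.
have /card_eqPle[_ Gj] : ((fun f => f j) @` G #= G)%card.
  by apply: inj_card_eq => f g /set_mem Gf /set_mem Gg; exact: Ginj Dj.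
apply: card_le_trans Gj (subset_card_le _) => _ [f Gf <-].
exact: GA.
Qed.

Lemma cardinal_minP {T : Type} (X : set (cardinal T)) : X !=set0 ->
  X (cardinal_min X) /\ forall d, X d -> cardinal_le (cardinal_min X) d.
Proof.
move=> X0; apply: (@xgetPex _ _
  [set c | X c /\ forall d, X d -> cardinal_le c d]).
(* With a representative [A c] of each cardinal [c], [X] itself is the index set for
   [exists_min_card]. *)
have [A cA] := choice (@cardinalityP T).
have [c Xc cmin] := exists_min_card X A X0.
by exists c; split=> // d Xd; rewrite (cA c) (cA d); apply/cardinal_leE/cmin.
Qed.

Lemma cardinal_le_maxl {T : Type} (c d : cardinal T) :
  cardinal_le c (cardinal_max c d).
Proof.
by rewrite /cardinal_max; case: asboolP => // _; exact: cardinal_le_refl.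
Qed.

Lemma cardinal_max_le {T : Type} (c d e : cardinal T) :
  cardinal_le c e -> cardinal_le d e -> cardinal_le (cardinal_max c d) e.
Proof. by rewrite /cardinal_max; case: ifP. Qed.

Lemma cardinal_sup1 {T : Type} (c : cardinal T) :
  cardinal_le (cardinal_sup [set c]) c.
Proof.
pose P := [set e : cardinal T | (forall d, [set c] d -> cardinal_le d e) /\
  forall e' : cardinal T, (forall d, [set c] d -> cardinal_le d e') ->
    cardinal_le e e'].
(* [c] is itself a least upper bound of [[set c]], so [xget] does not return its default. *)
have Pc : P c by split=> [d ->|e]; [exact: cardinal_le_refl|apply].
have [_ sup_le] : P (cardinal_sup [set c]) by exact: xgetI Pc.
by apply: sup_le => d ->; exact: cardinal_le_refl.
Qed.

Lemma card_set1_le {T U : Type} (x : T) (A : set U) :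
  A !=set0 -> ([set x] #<= A)%card.
Proof.
move=> [a Aa]; have /card_eqPle[xa _] := eq_card1 x a.
by apply: card_le_trans xa (subset_card_le _) => _ ->.
Qed.

Lemma card_II2_le {T : Type} (A : set T) (a b : T) :
  A a -> A b -> a <> b -> (`I_2 #<= A)%card.
Proof.
move=> Aa Ab ab; pose f n := if n is 0 then a else b.
have /card_eqPle[_ If] : (f @` `I_2 #= `I_2)%card.
  by apply: inj_card_eq => -[|[|m]] [|[|n]] /set_mem //= _ /set_mem //= _ /esym.
by apply: card_le_trans If (subset_card_le _) => _ [[|n] _ <-].
Qed.

Section Nakamura.
Variables (N : Type) (W : set (set N)).

Lemma nakamura_le (V : set (set N)) :
  V `<=` W -> \bigcap_(S in V) S = set0 ->
  nakamura W <=c Some (cardinality V).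
Proof.
move=> VW V0.
(* The larger family has the smaller intersection, so [nakamura W] is not [None]. *)
have W0 : \bigcap_(S in W) S = set0.
  by rewrite -subset0 -V0 => x Wx S /VW; exact: Wx.
rewrite /nakamura asboolT//=.
have [|_] := @cardinal_minP _ [set cardinality V | V in
  [set V | V `<=` W /\ \bigcap_(S in V) S = set0]].
  by exists (cardinality V), V.
by apply; exists V.
Qed.

Lemma nakamura_attained : nakamura W = None \/
  exists V, [/\ V `<=` W, \bigcap_(S in V) S = set0
              & nakamura W = Some (cardinality V)].
Proof.
rewrite /nakamura; case: asboolP => [W0|]; last by left.
right; have [|[V [VW V0] <-] _] := @cardinal_minP _ [set cardinality V | V in
  [set V | V `<=` W /\ \bigcap_(S in V) S = set0]].
  (* [W] itself is a candidate, so the minimum is over a nonempty set. *)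
  by exists (cardinality W), W => //; split=> // S.
by exists V.
Qed.

End Nakamura.

Section Kappa.
Variables (N : Type) (B W : set (set N)).

Let pair_cardinal (YZ : set (set N) * (set N -> set (set N))) :=
  cardinal_max (cardinality YZ.1)
    (cardinal_sup [set cardinality (YZ.2 S) | S in YZ.1]).

Lemma kappa_le YZ : cover_pairs B W YZ ->
  kappa B W <=c Some (pair_cardinal YZ).
Proof.
move=> MYZ; rewrite /kappa asboolF/=; last by move=> M0; rewrite M0 in MYZ.
have [|_] := @cardinal_minP _ (pair_cardinal @` cover_pairs B W).
  by exists (pair_cardinal YZ), YZ.
by apply; exists YZ.
Qed.

Lemma kappa_attained : kappa B W = None \/
  exists2 YZ, cover_pairs B W YZ & kappa B W = Some (pair_cardinal YZ).
Proof.
rewrite /kappa; case: asboolP => [|/eqP/set0P[YZ0 MYZ0]]; first by left.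
right; have [|[YZ MYZ E] _] :=
  @cardinal_minP _ (pair_cardinal @` cover_pairs B W).
  by exists (pair_cardinal YZ0), YZ0.
by exists YZ => //; rewrite E.
Qed.

End Kappa.

(** The empty family has intersection [[set: N]], which is not empty. *)
Lemma bigcap_set0_neq0 (N : Type) (V : set (set N)) :
  [set: N] !=set0 -> \bigcap_(S in V) S = set0 -> V !=set0.
Proof.
move=> [x _] V0; apply/set0P/eqP => VE.
by move: V0; rewrite VE bigcap_set0 => T0; have : [set: N] x by []; rewrite T0.
Qed.

Lemma nakamura_ge2 (N : Type) (W : set (set N)) :
  [set: N] !=set0 -> ~ W set0 -> Some (cardinality `I_2) <=c nakamura W.
Proof.
move=> N0 nW0; have [->//|[V [VW V0 ->]]] := nakamura_attained N W.
have [S VS] := bigcap_set0_neq0 N V N0 V0.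
have [S' VS' SS'] : exists2 S', V S' & S <> S'.
  (* Otherwise [V] is [[set S]], and its empty intersection is [S], a member of [W]. *)
  apply: contrapT => V1; apply: nW0; rewrite -V0.
  suff -> : V = [set S] by rewrite bigcap_set1; exact: VW.
  apply/seteqP; split=> [S' VS'|_ ->//].
  by apply/esym; apply: contrapT => SS'; apply: V1; exists S'.
by apply/cardinal_leE; exact: card_II2_le VS VS' SS'.
Qed.

Lemma nakamura_le_kappa (N : Type) (B W : set (set N)) :
  nakamura W <=c kappa B W.
Proof.
have [->|[[Y Z] [/= YW Zcover Z0] ->]] := kappa_attained N B W.
  by case: (nakamura W).
have Y0 : \bigcap_(S in Y) S = set0.
  rewrite -subset0 -Z0 => x Yx S YS.
  by have [_ _] := Zcover S YS; apply; exact: Yx.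
have := nakamura_le N W Y YW Y0; case: (nakamura W) => //= c cY.
(* [cardinality Y] is the first term of the maximum attached to [(Y, Z)]. *)
exact: cardinal_le_trans cY (cardinal_le_maxl _ _).
Qed.

Lemma kappa_le_nakamura (N : Type) (B W : set (set N)) :
  [set: N] !=set0 -> kappa B W <=c nakamura (W `&` B).
Proof.
move=> N0; have [->|[V [VWB V0 ->]]] := nakamura_attained N (W `&` B).
  by case: (kappa B W).
(* As [V] is nonempty, the supremum below runs over the cardinal 1 alone, and 1 is at most the
   cardinal of [V]. *)
have [S VS] := bigcap_set0_neq0 N V N0 V0.
have MV : cover_pairs B W (V, fun S => [set S]).
  split=> /= [S' /VWB[]//|S' VS'|].
    (* The singleton is a collection of members of [B] because [V] lies in the intersection of [W]
       with [B]. *)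
    split; [by exists S'|by move=> _ ->; have [] := VWB _ VS'|].
    by rewrite bigcup_set1.
  by rewrite -V0; apply: eq_bigcapr => S' _; rewrite bigcup_set1.
have := kappa_le N B W _ MV; case: (kappa B W) => //= c cV.
apply: cardinal_le_trans cV _; apply: cardinal_max_le.
  exact: cardinal_le_refl.
have -> : [set cardinality [set S'] | S' in V] = [set cardinality [set S]].
  apply/seteqP; split=> [_ [S' _ <-]|_ ->]; last by exists S.
  by apply/cardinality_eqE; exact: eq_card1.
apply: cardinal_le_trans (cardinal_sup1 _) _.
by apply/cardinal_leE; apply: card_set1_le; exists S.
Qed.

Theorem lemma9 (N : Type) (B B' W' : set (set N)) :
  [set: N] !=set0 ->
  boolean_algebra B ->
  B `<=` B' ->
  winning_sets B' W' ->
  let W := W' `&` B in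
  [/\ Some (cardinality `I_2) <=c nakamura W',
      nakamura W' <=c kappa B W'
    & kappa B W' <=c nakamura W].
Proof.
move=> N0 _ _ [_ nW0 _] W; split.
- exact: nakamura_ge2.
- exact: nakamura_le_kappa.
- exact: kappa_le_nakamura.
Qed.
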